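(* Let $V$ and $W$ be two linear subspaces of a pre-locality vector space $(E,\top)$ over $\mathbb{K}$, let $G$ be a $\mathbb{K}$-vector space and let $f_\top:V\times_\top W\to G$ be a $\top_\times$-bilinear map. There is a unique $\mathbb{K}$-linear map $\phi_{f_\top}:V\otimes_\top W\to G$ such that $f_\top=\phi_{f_\top}\circ\otimes_\top$.
   Context: $\mathbb{K}$ is $\mathbb{R}$ or $\mathbb{C}$. A pre-locality vector space is a $\mathbb{K}$-vector space $E$ with a symmetric relation $\top\subset E\times E$ such that $(0,0)\in\top$. For subspaces $V,W\subset E$, $V\times_\top W:=\top\cap(V\times W)$. $\mathbb{K}(X)$ denotes the free vector space on a set $X$. $I_{\rm bil}\subset\mathbb{K}(V\times W)$ is the linear subspace generated by all elements $(a+b,x)-(a,x)-(b,x)$, $(a,x+y)-(a,x)-(a,y)$, $(ka,x)-k(a,x)$, $(a,kx)-k(a,x)$ with $a,b\in V$, $x,y\in W$, $k\in\mathbb{K}$. Set $I_{\rm bil}^{\top_\times}:=\mathbb{K}(V\times_\top W)\cap I_{\rm bil}$. The locality tensor product is $V\otimes_\top W:=\mathbb{K}(V\times_\top W)/I_{\rm bil}^{\top_\times}$, and $\otimes_\top:V\times_\top W\to V\otimes_\top W$ is the composition of the canonical inclusion $V\times_\top W\to\mathbb{K}(V\times_\top W)$ with the quotient map. A map $f:V\times_\top W\to G$ is $\top_\times$-bilinear if its linear extension $\bar f:\mathbb{K}(V\times_\top W)\to G$ satisfies $\bar f(I_{\rm bil}^{\top_\times})=\{0_G\}$. *)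

(* Defs.v *)
From HB Require Import structures.
From mathcomp Require Import all_boot all_order all_algebra ring_quotient.
From mathcomp Require Import boolp classical_sets reals complex freeg.

Set Implicit Arguments.
Unset Strict Implicit.
Unset Printing Implicit Defensive.

Import GRing.Theory.

Local Open Scope classical_set_scope.
Local Open Scope complex_scope.
Local Open Scope quotient_scope.
Local Open Scope ring_scope.

Inductive scalar_kind := RealScalars | ComplexScalars.

Definition scalar_field (R : realType) (k : scalar_kind) : fieldType :=
  match k with
  | RealScalars => R
  | ComplexScalars => R[i]
  end.

HB.mixin Record Lmodule_isPreLocality (K : fieldType) E
    of GRing.Lmodule K E := {
  locrel : E -> E -> Prop ;
  locrel_sym : forall x y : E, locrel x y -> locrel y x ;
  locrel00 : locrel 0 0
}.

#[short(type="preLocVectType")]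
HB.structure Definition PreLocVect (K : fieldType) :=
  {E of GRing.Lmodule K E & Lmodule_isPreLocality K E}.

Section Subspace.
Context (K : fieldType) (E : lmodType K) (V : submodClosed E).

Definition subspace_of := {x : E | x \in V}.

HB.instance Definition _ := SubType.on subspace_of.
HB.instance Definition _ := Choice.on subspace_of.
HB.instance Definition _ := [SubChoice_isSubLmodule of subspace_of by <:].

End Subspace.

Section Span.
Context (K : fieldType) (M : lmodType K) (S : set M).

Definition span : set M := smallest [set A : set M | submod_closed [in A]] S.

Lemma span_submod_closed : submod_closed [in span].
Proof.
split=> [|a u v].
  by rewrite inE => A [[A0 _] _]; apply: set_mem.
rewrite !inE => Su Sv A [clA sSA]; apply: set_mem.
by apply: clA.2; apply: mem_set; [apply: Su | apply: Sv].
Qed.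

End Span.

Section FreeLift.
Context (K : fieldType) (X : choiceType) (M : lmodType K) (f : X -> M).

Let lift_zmod_morphism : zmod_morphism (@fglift K M X f) :=
  lift_is_additive f.

HB.instance Definition _ := GRing.isZmodMorphism.Build
  {freeg X / K} M (@fglift K M X f) lift_zmod_morphism.

Let lift_scalable : scalable (@fglift K M X f).
Proof.
move=> a D; rewrite -[in RHS](freeg_sumE D) !raddf_sum.
by apply: eq_bigr => x _ /=; rewrite !liftU scalerA.
Qed.

HB.instance Definition _ := GRing.isScalable.Build K
  {freeg X / K} M *:%R (@fglift K M X f) lift_scalable.

End FreeLift.

(* [Quotient.quot] provides only the additive group structure of [M / I]. *)
Section QuotientModule.
Context (K : fieldType) (M : lmodType K) (I : submodClosed M).

Definition submod_pred : {pred M} := fun x => x \in I.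

Let submod_pred_zmod_closed : zmod_closed submod_pred.
Proof. exact: GRing.submod_closedB (submodClosedP I). Qed.

HB.instance Definition _ :=
  GRing.isZmodClosed.Build M submod_pred submod_pred_zmod_closed.

Definition quotmod := Quotient.quot submod_pred.

HB.instance Definition _ := EqQuotient.on quotmod.
HB.instance Definition _ := GRing.Zmodule.on quotmod.

Definition quotmod_scale (a : K) := lift_op1 quotmod ( *:%R a).

Let pi_scale a : {morph \pi_quotmod : x / a *: x >-> quotmod_scale a x}.
Proof.
move=> x; unlock quotmod_scale; apply/eqP; rewrite -Quotient.idealrBE.
rewrite -scalerBr unfold_in; apply: rpredZ.
by rewrite -[_ \in I]/(_ \in submod_pred) Quotient.idealrBE reprK.
Qed.

Let piD : {morph \pi_quotmod : x y / x + y >-> x + y}.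
Proof. exact: (@Quotient.pi_add _ submod_pred). Qed.

Let scaleA a b x :
  quotmod_scale a (quotmod_scale b x) = quotmod_scale (a * b) x.
Proof. by elim/quotW: x => x; rewrite -!pi_scale scalerA. Qed.

Let scale1 : left_id 1 quotmod_scale.
Proof. by elim/quotW => x; rewrite -pi_scale scale1r. Qed.

Let scaleDr : right_distributive quotmod_scale +%R.
Proof.
move=> a; elim/quotW => x; elim/quotW => y.
by rewrite -piD -!pi_scale scalerDr piD.
Qed.

Let scaleDl x : {morph quotmod_scale^~ x : a b / a + b}.
Proof. by move=> a b; elim/quotW: x => x; rewrite -!pi_scale scalerDl piD. Qed.

HB.instance Definition _ := GRing.Zmodule_isLmodule.Build K quotmod
  scaleA scale1 scaleDr scaleDl.

End QuotientModule.

Section TensorProduct.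
Context (K : fieldType) (E : preLocVectType K) (V W : submodClosed E).

Local Notation VW := (subspace_of V * subspace_of W)%type.

(* V x_T W; it is used below as a type through [set_type]. *)
Definition locprod : set VW := [set p | locrel (val p.1) (val p.2)].

Definition bil_generators : set {freeg VW / K} :=
  [set g | exists a b x, g = << (a + b, x) >> - << (a, x) >> - << (b, x) >>]
  `|` [set g | exists a x y,
         g = << (a, x + y) >> - << (a, x) >> - << (a, y) >>]
  `|` [set g | exists (k : K) a x,
         g = << (k *: a, x) >> - k *: << (a, x) >>]
  `|` [set g | exists (k : K) a x,
         g = << (a, k *: x) >> - k *: << (a, x) >>].

Definition Ibil : set {freeg VW / K} := span bil_generators.

Definition free_incl : {freeg locprod / K} -> {freeg VW / K} :=
  fglift (fun p : locprod => << val p >>).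

(* K(V x_T W) is the free space on a subtype of V x W, so its intersection with
   [Ibil] is the preimage of [Ibil] under the (injective) inclusion into
   K(V x W). *)
Definition Ibil_loc : {pred {freeg locprod / K}} :=
  fun u => free_incl u \in Ibil.

Let Ibil_loc_submod_closed : subsemimod_closed Ibil_loc.
Proof.
apply: GRing.submod_closed_semi.
have [I0 IL] := span_submod_closed bil_generators.
split=> [|a u v uI vI]; rewrite unfold_in /Ibil_loc /free_incl.
  by rewrite raddf0.
by rewrite linearP; apply: IL.
Qed.

HB.instance Definition _ := GRing.isSubmodClosed.Build K
  {freeg locprod / K} Ibil_loc Ibil_loc_submod_closed.

Definition loctensor := quotmod Ibil_loc.

HB.instance Definition _ := GRing.Lmodule.on loctensor.

Definition loctens (p : locprod) : loctensor := \pi_loctensor << p >>.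

(* [fglift f] is the linear extension of [f] to K(V x_T W). *)
Definition loc_bilinear (G : lmodType K) (f : locprod -> G) : Prop :=
  fglift f @` [set` Ibil_loc] = [set 0].

End TensorProduct.

Arguments locprod {K E} V W.
Arguments bil_generators {K E} V W.
Arguments Ibil {K E} V W.
Arguments free_incl {K E} V W.
Arguments Ibil_loc {K E} V W.
Arguments loctensor {K E} V W.
Arguments loctens {K E} V W.

(* Main.v *)
From HB Require Import structures.
Require Import Defs.
From mathcomp Require Import all_boot all_order all_algebra ring_quotient.
From mathcomp Require Import boolp classical_sets reals freeg.

(** Two universal properties compose. A map on a set extends uniquely to a
    linear map on the free space over that set, and a linear map on [M] that
    vanishes on a subspace [I] factors uniquely through [M / I]. Being
    bilinear in the locality sense means exactly that the linear extension
    [fglift f] vanishes on [Ibil_loc], so it descends to the locality tensor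
    product ([quotmod_lift_linear], [quotmod_liftE]).  Uniqueness holds because
    the quotient map is onto and the free space is spanned by its generators,
    so a linear map on the tensor product is determined by its values on pure
    tensors ([loctensor_linear_ext]). *)

Set Implicit Arguments.
Unset Strict Implicit.
Unset Printing Implicit Defensive.

Import GRing.Theory.

Local Open Scope quotient_scope.
Local Open Scope ring_scope.

(** * Linear maps out of a quotient module *)

Section QuotientUniversal.
Context (K : fieldType) (M : lmodType K) (I : submodClosed M).

Local Notation piI := (fun x : M => \pi_(quotmod I) x).

Lemma eq_quotmod (x y : M) : (piI x == piI y) = (x - y \in I).
Proof. by rewrite -Quotient.idealrBE. Qed.

Lemma sub_repr_pi (x : M) : repr (piI x) - x \in I.
Proof. by rewrite -eq_quotmod reprK. Qed.

Lemma quotmod_pi_linear : linear piI.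
Proof.
move=> a x y; rewrite [LHS](@Quotient.pi_add _ (submod_pred I)).
congr (_ + _).
(* The scaling of the quotient rescales the canonical representative. *)
rewrite [RHS]/GRing.scale /=; unlock quotmod_scale.
by apply/esym/eqP; rewrite eq_quotmod -scalerBr rpredZ // sub_repr_pi.
Qed.

(** Evaluating on the chosen representative of a class is independent of that
    choice once [h] vanishes on [I], which is what [quotmod_liftE] records. *)
Definition quotmod_lift (G : lmodType K) (h : M -> G) (t : quotmod I) : G :=
  h (repr t).

Context (G : lmodType K) (h : {linear M -> G}).
Hypothesis h_vanish : {in I, forall x, h x = 0}.

Lemma quotmod_liftE x : quotmod_lift h (piI x) = h x.
Proof. by apply/eqP; rewrite -subr_eq0 -linearB h_vanish // sub_repr_pi. Qed.

Lemma quotmod_lift_linear : linear (quotmod_lift h).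
Proof.
move=> a; elim/quotW => x; elim/quotW => y.
by rewrite -quotmod_pi_linear !quotmod_liftE linearP.
Qed.

End QuotientUniversal.

(** * Linear maps out of a free module *)

Lemma freegUE (K : fieldType) (X : choiceType) (c : K) (x : X) :
  << c *g x >> = c *: << x >> :> {freeg X / K}.
Proof. by apply/eqP/freeg_eqP => y; rewrite coeffZ !coeffU mul1r. Qed.

(** Every element is a finite combination of generators. Linearity is a premise
    rather than bundled, since the maps compared for uniqueness are arbitrary
    functions known to be linear. *)
Lemma freeg_linear_ext (K : fieldType) (X : choiceType) (G : lmodType K)
    (g h : {freeg X / K} -> G) :
  linear g -> linear h -> (forall x, g << x >> = h << x >>) -> g =1 h.
Proof.
move=> g_lin h_lin gh D.
(* Bundling [g] and [h] as linear maps gives access to [linear_sum]. *)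
pose gL := GRing.isLinear.Build K {freeg X / K} G *:%R g g_lin.
pose hL := GRing.isLinear.Build K {freeg X / K} G *:%R h h_lin.
pose g' : {linear {freeg X / K} -> G} := HB.pack g gL.
pose h' : {linear {freeg X / K} -> G} := HB.pack h hL.
rewrite -[g]/(g' : _ -> _) -[h]/(h' : _ -> _).
rewrite -(freeg_sumE D) !linear_sum; apply: eq_bigr => x _.
by rewrite freegUE !linearZ; congr (_ *: _); apply: gh.
Qed.

(** * The locality tensor product *)

Section LocalityTensor.
Context (K : fieldType) (E : preLocVectType K) (V W : submodClosed E).
Context (G : lmodType K).

(** Composed with the quotient map, [phi] and [psi] become linear maps on the
    free space that agree on its generators; the quotient map being onto, they
    agree everywhere. *)
Lemma loctensor_linear_ext (phi psi : loctensor V W -> G) :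
  linear phi -> linear psi ->
  phi \o loctens V W = psi \o loctens V W -> phi = psi.
Proof.
move=> phi_lin psi_lin eq_tens; apply/funext; elim/quotW.
have pi_comp_linear (chi : loctensor V W -> G) : linear chi ->
    linear (fun x => chi (\pi_(loctensor V W) x)).
  by move=> chi_lin a x y; rewrite quotmod_pi_linear chi_lin.
apply: freeg_linear_ext; [exact: pi_comp_linear.. |] => p.
exact: (congr1 (@^~ p) eq_tens).
Qed.

Lemma loc_bilinear_vanish (f : locprod V W -> G) :
  loc_bilinear f -> {in Ibil_loc V W, forall u, fglift f u = 0}.
Proof.
move=> f_bil u uI.
by have : (fglift f @` [set` Ibil_loc V W])%classic (fglift f u);
  [exists u | rewrite f_bil].
Qed.

End LocalityTensor.

Theorem theorem1p15 (R : realType) (k : scalar_kind)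
    (E : preLocVectType (scalar_field R k)) (V W : submodClosed E)
    (G : lmodType (scalar_field R k)) (f : locprod V W -> G) :
  loc_bilinear f ->
  exists! phi : loctensor V W -> G, linear phi /\ f = phi \o loctens V W.
Proof.
move=> /loc_bilinear_vanish f_vanish.
exists (quotmod_lift (I := Ibil_loc V W) (fglift f)).
have lift_tens : f = quotmod_lift (fglift f) \o loctens V W.
  by apply/funext => p; rewrite /= (quotmod_liftE f_vanish) /= liftU scale1r.
have lift_lin := quotmod_lift_linear f_vanish.
split=> [|phi [phi_lin phi_tens]]; first by split.
by apply: loctensor_linear_ext => //; rewrite -lift_tens.
Qed.
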